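(* Let $P$ be the probability measure on $\{1,2,3,4,5,6\}\subset\mathbb{R}$ with probability mass function $f(j)=\left(\frac{3}{10}\right)^{j-1}\frac{7}{10}$ for $j\in\{1,2,3,4,5\}$ and $f(6)=\left(\frac{3}{10}\right)^{5}$. The optimal set of four-means for $P$ is $\{1,2,3,a[4,6]\}$, with quantization error $V_4(P)=\frac{112833}{10000000}$.
   Context: For a Borel probability measure $P$ on $\mathbb{R}$ and a nonempty finite set $\alpha\subset\mathbb{R}$, the distortion error is $V(P;\alpha)=\int\min_{a\in\alpha}|x-a|^2\,dP(x)$. The $n$th quantization error is $V_n(P)=\inf\{V(P;\alpha):\alpha\subset\mathbb{R},\ 1\le\mathrm{card}(\alpha)\le n\}$, and a set $\alpha$ with $1\le\mathrm{card}(\alpha)\le n$ attaining this infimum is called an optimal set of $n$-means for $P$. For $i\le j$ in $\{1,\dots,6\}$, $a[i,j]=\dfrac{\sum_{k=i}^{j}k f(k)}{\sum_{k=i}^{j}f(k)}$. *)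

(* Defs.v *)
From HB Require Import structures.
From mathcomp Require Import all_boot all_order all_algebra finmap.
From mathcomp Require Import all_classical all_reals all_analysis.
From mathcomp Require Import ring lra.

Set Implicit Arguments.
Unset Strict Implicit.
Unset Printing Implicit Defensive.

Import Order.TTheory GRing.Theory Num.Theory.
Import numFieldNormedType.Exports.

Local Open Scope classical_set_scope.
Local Open Scope ring_scope.
Local Open Scope ereal_scope.

Section quantization.
Context {R : realType}.
Implicit Types (P : probability (measurableTypeR R) R) (alpha : {fset R}).

(* +oo is neutral for mine, so this is the integral of the pointwise minimum
   as soon as alpha is nonempty. *)
Definition distortion P alpha : \bar R :=
  \int[P]_x \big[mine/+oo]_(a <- alpha) (`|x - a| ^+ 2)%:E.

Definition admissible (n : nat) : set {fset R} :=
  [set alpha | (1 <= #|` alpha| <= n)%N].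

Definition quantization_error (n : nat) P : \bar R :=
  ereal_inf [set distortion P alpha | alpha in admissible n].

Definition optimal_means (n : nat) P alpha : Prop :=
  admissible n alpha /\ distortion P alpha = quantization_error n P.

End quantization.

Section truncated_geometric.
Variable R : realType.

Definition f (j : nat) : R :=
  if (1 <= j <= 5)%N then ((3 / 10) ^+ (j - 1) * (7 / 10))%R
  else if j == 6%N then ((3 / 10) ^+ 5)%R
  else 0%R.

Lemma f_ge0 (j : nat) : (0 <= f j)%R.
Proof.
rewrite /f; case: ifP => _; last case: ifP => _ //.
by rewrite mulr_ge0 ?exprn_ge0 ?divr_ge0.
Qed.

Definition f_nng (j : nat) : {nonneg R} := NngNum (f_ge0 j).

(* The sum of the point masses f k at k, for k = 1, ..., 6. *)
Definition Pf : set (measurableTypeR R) -> \bar R :=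
  msum (fun k => mscale (f_nng k.+1) (dirac (k.+1%:R : measurableTypeR R))) 6.

HB.instance Definition _ := Measure.on Pf.

Lemma Pf_setT : Pf [set: _] = 1.
Proof.
rewrite /Pf /msum !big_ord_recr big_ord0 /= /mscale /= !diracT !mule1 add0e.
by rewrite /f /= -!EFinD; congr EFin; field.
Qed.

HB.instance Definition _ := Measure_isProbability.Build _ _ _ Pf Pf_setT.

Lemma Pf1 (j : nat) : (1 <= j <= 6)%N -> Pf [set j%:R] = (f j)%:E.
Proof.
case: j => // j /andP[_ j6].
rewrite /Pf /msum (bigD1 (Ordinal j6)) //= big1 => [|i ij].
  by rewrite adde0 /mscale /= diracE mem_set// mule1.
rewrite /mscale /= diracE memNset ?mule0// => /eqP.
by rewrite eqr_nat eqSS => /eqP ji; case/eqP: ij; apply: val_inj.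
Qed.

Definition a (i j : nat) : R :=
  ((\sum_(i <= k < j.+1) k%:R * f k) / (\sum_(i <= k < j.+1) f k))%R.

End truncated_geometric.

Arguments Pf : clear implicits.

(* Main.v *)
(* Send each atom k to a nearest point c_k of alpha.  If two atoms i, j share
   their center, they alone cost at least f_i f_j (j - i)^2 / (f_i + f_j), which
   exceeds V_4 as soon as one of them is 1, 2 or 3.  Otherwise c_1, c_2, c_3 are
   isolated, so four centers force c_4 = c_5 = c_6, and completing the square
   around a[4,6] gives the bound together with its equality case. *)
Require Import Defs.
From mathcomp Require Import all_boot all_order all_algebra finmap.
From mathcomp Require Import all_classical all_reals all_analysis.
From mathcomp Require Import measurable_realfun.
From mathcomp Require Import ring lra.

Import Order.TTheory GRing.Theory Num.Theory.
Import numFieldNormedType.Exports.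

Local Open Scope ring_scope.

Section distortion_Pf.
Context {R : realType}.
Implicit Types (alpha : {fset R}) (s : seq R).

Lemma bigmine_ge0 s (x : R) :
  (0 <= \big[mine/+oo]_(a <- s) (`|x - a| ^+ 2)%:E)%E.
Proof.
by elim/big_rec: _ => [|a y _ y0]; rewrite ?leey // le_min y0 lee_fin sqr_ge0.
Qed.

Lemma measurable_bigmine s :
  measurable_fun [set: measurableTypeR R]
    (fun x => \big[mine/+oo]_(a <- s) (`|x - a| ^+ 2)%:E)%E.
Proof.
elim: s => [|c s IH].
  by under eq_fun do rewrite big_nil; exact: measurable_cst.
under eq_fun do rewrite big_cons.
apply: measurable_mine => //; apply/measurable_EFinP.
apply: measurable_funX; apply: measurableT_comp => //.
exact: measurable_funB.
Qed.

(** The induction starts at a singleton because the minimum over the empty list is [+oo], which no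
    center attains. *)
Lemma bigmine_attained s (x : R) : s != [::] ->
  exists2 c, c \in s &
    (\big[mine/+oo]_(a <- s) (`|x - a| ^+ 2)%:E)%E = ((x - c) ^+ 2)%:E.
Proof.
elim: s => // c [|d s] IH _.
  by exists c; rewrite ?mem_head// big_seq1 real_normK ?num_real.
have [//|e eds IHe] := IH; rewrite big_cons IHe real_normK ?num_real//.
case: leP => _; first by exists c; rewrite ?mem_head.
by exists e; rewrite // inE eds orbT.
Qed.

Lemma distortion_PfE alpha :
  distortion (Pf R) alpha =
  (\sum_(k < 6) (f R k.+1)%:E *
     \big[mine/+oo]_(a <- alpha) (`|k.+1%:R - a| ^+ 2)%:E)%E.
Proof.
rewrite /distortion.
rewrite (@ge0_integral_measure_sum _ _ _
  (fun k => mscale (f_nng R k.+1) (dirac (k.+1%:R : measurableTypeR R))) setT _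
  (fun x : measurableTypeR R =>
     \big[mine/+oo]_(a <- alpha) (`|x - a| ^+ 2)%:E)%E _ _ 6%N) //.
- apply: eq_bigr => k _.
  rewrite ge0_integral_mscale//; first last.
  + by move=> x _; exact: bigmine_ge0.
  + exact: measurable_bigmine.
  rewrite integral_dirac ?diracT ?mul1e//; exact: measurable_bigmine.
- by move=> x _; exact: bigmine_ge0.
- exact: measurable_bigmine.
Qed.

End distortion_Pf.


Section four_means.
Context {R : realType}.
Implicit Types (alpha : {fset R}) (x y z : R).

Let V : R := (112 * 10 ^+ 3 + 833) / 10 ^+ 7.

Lemma f_values :
  [/\ f R 1 = 7 / 10, f R 2 = 21 / 100 & f R 3 = 63 / 1000] /\
  [/\ f R 4 = 189 / 10 ^+ 4, f R 5 = 567 / 10 ^+ 5 & f R 6 = 243 / 10 ^+ 5].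
Proof. by split; split; rewrite /f /=; field. Qed.

Lemma a46E : a R 4 6 = 439 / 100.
Proof.
have [_ [f4 f5 f6]] := f_values.
by rewrite /a unlock /= f4 f5 f6; field.
Qed.

(** The difference of the two sides is a perfect square, zero when [c] is the barycenter of masses
    [p] at [i] and [q] at [j]. Multiplying through by [p + q] avoids division. *)
Lemma shared_center_bound (p q i j c : R) :
  p * q * (j - i) ^+ 2 <= (p + q) * (p * (i - c) ^+ 2 + q * (j - c) ^+ 2).
Proof.
rewrite -subr_ge0; set d := (X in 0 <= X).
suff -> : d = (p * (i - c) + q * (j - c)) ^+ 2 by exact: sqr_ge0.
by rewrite /d; ring.
Qed.

Let cost (c1 c2 c3 c4 c5 c6 : R) : R :=
  f R 1 * (1 - c1) ^+ 2 + f R 2 * (2 - c2) ^+ 2 + f R 3 * (3 - c3) ^+ 2 +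
  f R 4 * (4 - c4) ^+ 2 + f R 5 * (5 - c5) ^+ 2 + f R 6 * (6 - c6) ^+ 2.

(** The hypothesis covers the twelve pairs of atoms not contained in {4, 5, 6}. The tightest pair is
    3, 4, which costs at least about 0.0145, against [V] of about 0.0113. *)
Lemma cost_gt (c1 c2 c3 c4 c5 c6 : R) :
  (c1 \in [:: c2; c3; c4; c5; c6]) || (c2 \in [:: c3; c4; c5; c6])
    || (c3 \in [:: c4; c5; c6]) ->
  V < cost c1 c2 c3 c4 c5 c6.
Proof.
have [[f1 f2 f3] [f4 f5 f6]] := f_values.
have s1 := sqr_ge0 (1 - c1); have s2 := sqr_ge0 (2 - c2).
have s3 := sqr_ge0 (3 - c3); have s4 := sqr_ge0 (4 - c4).
have s5 := sqr_ge0 (5 - c5); have s6 := sqr_ge0 (6 - c6).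
rewrite !inE /cost /V f1 f2 f3 f4 f5 f6.
move=> /orP[/orP[/or4P[/eqP e|/eqP e|/eqP e|/orP[/eqP e|/eqP e]]|
  /or4P[/eqP e|/eqP e|/eqP e|/eqP e]]|/or3P[/eqP e|/eqP e|/eqP e]].
(* Rewriting only the second occurrence of the center makes both squares of the bound terms of
   [cost]; the other four terms are nonnegative. *)
- have := shared_center_bound (7 / 10) (21 / 100) 1 2 c1; rewrite {2}e; lra.
- have := shared_center_bound (7 / 10) (63 / 1000) 1 3 c1; rewrite {2}e; lra.
- have := shared_center_bound (7 / 10) (189 / 10 ^+ 4) 1 4 c1; rewrite {2}e; lra.
- have := shared_center_bound (7 / 10) (567 / 10 ^+ 5) 1 5 c1; rewrite {2}e; lra.
- have := shared_center_bound (7 / 10) (243 / 10 ^+ 5) 1 6 c1; rewrite {2}e; lra.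
- have := shared_center_bound (21 / 100) (63 / 1000) 2 3 c2; rewrite {2}e; lra.
- have := shared_center_bound (21 / 100) (189 / 10 ^+ 4) 2 4 c2; rewrite {2}e; lra.
- have := shared_center_bound (21 / 100) (567 / 10 ^+ 5) 2 5 c2; rewrite {2}e; lra.
- have := shared_center_bound (21 / 100) (243 / 10 ^+ 5) 2 6 c2; rewrite {2}e; lra.
- have := shared_center_bound (63 / 1000) (189 / 10 ^+ 4) 3 4 c3; rewrite {2}e; lra.
- have := shared_center_bound (63 / 1000) (567 / 10 ^+ 5) 3 5 c3; rewrite {2}e; lra.
- have := shared_center_bound (63 / 1000) (243 / 10 ^+ 5) 3 6 c3; rewrite {2}e; lra.
Qed.

(** Parallel axis identity for the atoms 4, 5, 6: their total mass is [27 / 1000], their barycenter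
    is [a R 4 6], and [V] is their cost around it. *)
Lemma costE (c1 c2 c3 c : R) :
  cost c1 c2 c3 c c c = V + (f R 1 * (1 - c1) ^+ 2 + f R 2 * (2 - c2) ^+ 2 +
    f R 3 * (3 - c3) ^+ 2 + (27 / 1000) * (a R 4 6 - c) ^+ 2).
Proof.
have [[f1 f2 f3] [f4 f5 f6]] := f_values.
by rewrite /cost /V a46E f1 f2 f3 f4 f5 f6; field.
Qed.

Lemma cost_min (c1 c2 c3 c : R) :
  V <= cost c1 c2 c3 c c c ?= iff
    [&& c1 == 1, c2 == 2, c3 == 3 & c == a R 4 6].
Proof.
have [[f1 f2 f3] _] := f_values.
have s1 := sqr_ge0 (1 - c1); have s2 := sqr_ge0 (2 - c2).
have s3 := sqr_ge0 (3 - c3); have s4 := sqr_ge0 (a R 4 6 - c).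
rewrite costE f1 f2 f3; split; first by lra.
apply/eqP/and4P => [e|[/eqP-> /eqP-> /eqP-> /eqP->]]; last first.
  by rewrite !subrr expr0n /= !mulr0 !addr0.
(* Nonnegative squares with positive weights add up to zero, so each one vanishes. *)
by split; rewrite eq_sym -subr_eq0 -sqrf_eq0; apply/eqP; lra.
Qed.

(** From here on only coincidences among six real centers matter, and the integral is gone. *)
Lemma nearest_centers alpha : alpha != fset0 ->
  exists c : nat -> R, (forall k, c k \in alpha) /\
    distortion (Pf R) alpha =
    (cost (c 1%N) (c 2%N) (c 3%N) (c 4%N) (c 5%N) (c 6%N))%:E.
Proof.
move=> alpha0.
have alphaN0 : (alpha : seq R) != [::].
  apply: contra alpha0 => /eqP e; apply/eqP/fsetP => x.
  by rewrite in_fset0 -[x \in alpha]/(x \in (alpha : seq R)) e.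
have /choice[c cP] : forall k : nat, exists c, c \in alpha /\
    (\big[mine/+oo]_(a <- alpha) (`|k%:R - a| ^+ 2)%:E)%E =
    ((k%:R - c) ^+ 2)%:E :> \bar R.
  move=> k; have [c cs ce] := bigmine_attained _ (k%:R : R) alphaN0.
  by exists c.
exists c; split=> [k|]; first by have [] := cP k.
have ce k : (\big[mine/+oo]_(a <- alpha) (`|k%:R - a| ^+ 2)%:E)%E =
    ((k%:R - c k) ^+ 2)%:E :> \bar R by have [] := cP k.
rewrite distortion_PfE !big_ord_recr big_ord0 /= add0e.
by rewrite !ce -!EFinM -!EFinD.
Qed.

Let means : {fset R} := [fset 1; 2; 3; a R 4 6]%fset.

Lemma card_means : #|` means| = 4%N.
Proof.
have us : uniq [:: 1; 2; 3; a R 4 6].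
  rewrite /= !inE !negb_or a46E !andbT -!andbA.
  by do ![apply/andP; split]; apply/eqP; lra.
rewrite (perm_size (uniq_perm (fset_uniq means) us _)) // => x.
by rewrite !inE !orbA.
Qed.

Lemma distortion_Pf_ge alpha : admissible 4 alpha ->
  (V%:E <= distortion (Pf R) alpha)%E /\
  (distortion (Pf R) alpha = V%:E -> alpha = means).
Proof.
move=> /andP[alpha1 alpha4].
have alpha0 : alpha != fset0 by rewrite -cardfs_gt0.
have [c [cin ->]] := nearest_centers _ alpha0.
have [/cost_gt lt|] := boolP ((c 1%N \in [:: c 2%N; c 3%N; c 4%N; c 5%N; c 6%N])
  || (c 2%N \in [:: c 3%N; c 4%N; c 5%N; c 6%N])
  || (c 3%N \in [:: c 4%N; c 5%N; c 6%N])).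
  split; first by rewrite lee_fin ltW.
  by move=> [e]; rewrite e ltxx in lt.
rewrite !inE !negb_or => /andP[/andP[/and5P[n12 n13 n14 n15 n16]
  /and4P[n23 n24 n25 n26]] /and3P[n34 n35 n36]].
have cs s : {subset [seq c k | k <- s] <= (alpha : seq R)}.
  by move=> _ /mapP[k _ ->]; exact: cin.
(* Otherwise the centers of 1, 2, 3, 4, 5 would be five distinct points of [alpha]. *)
have e45 : c 5%N = c 4%N.
  apply/eqP; apply: contraTT alpha4 => n54; rewrite -ltnNge.
  apply: (@uniq_leq_size _ _ _ _ (cs [:: 1; 2; 3; 4; 5]%N)).
  by rewrite /= !inE !negb_or n12 n13 n14 n15 n23 n24 n25 n34 n35 eq_sym n54.
have e46 : c 6%N = c 4%N.
  apply/eqP; apply: contraTT alpha4 => n64; rewrite -ltnNge.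
  apply: (@uniq_leq_size _ _ _ _ (cs [:: 1; 2; 3; 4; 6]%N)).
  by rewrite /= !inE !negb_or n12 n13 n14 n16 n23 n24 n26 n34 n36 eq_sym n64.
rewrite e45 e46; have [le eqV] := cost_min (c 1%N) (c 2%N) (c 3%N) (c 4%N).
split; first by rewrite lee_fin.
move=> [/eqP]; rewrite eq_sym eqV => /and4P[/eqP c1 /eqP c2 /eqP c3 /eqP c4].
(* Since [alpha] has at most four points, it is enough that it contains the four points of
   [means]. *)
apply/esym/eqP; rewrite eqEfcard card_means alpha4 andbT.
apply/fsubsetP => x; rewrite !inE -c4 -c3 -c2 -c1.
by move=> /orP[/orP[/orP[]|]|] /eqP->; exact: cin.
Qed.

Lemma means_admissible : admissible 4 means.
Proof. by rewrite /admissible /= card_means. Qed.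

Lemma distortion_means : distortion (Pf R) means = V%:E.
Proof.
apply/eqP; rewrite eq_le.
rewrite (distortion_Pf_ge _ means_admissible).1 andbT.
(* Only the upper bound remains. With [V] written as the cost of sending 1, 2, 3 to themselves and
   4, 5, 6 to [a R 4 6], each minimum need only be bounded by its value at the assigned center. *)
have := costE 1 2 3 (a R 4 6); rewrite !subrr expr0n /= !mulr0 !addr0 => <-.
rewrite distortion_PfE !big_ord_recr big_ord0 /= add0e /cost !EFinD.
have le (k : nat) x : x \in means ->
  ((f R k)%:E * \big[mine/+oo]_(a <- means) (`|k%:R - a| ^+ 2)%:E <=
    (f R k * (k%:R - x) ^+ 2)%:E)%E.
  move=> xin; rewrite EFinM; apply: lee_wpmul2l; first by rewrite lee_fin f_ge0.
  apply: bigmin_inf_seq xin _ _ => //.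
  by rewrite real_normK ?num_real.
apply: (leeD (leeD (leeD (leeD (leeD (le 1%N 1 _) (le 2%N 2 _)) (le 3%N 3 _))
  (le 4%N _ _)) (le 5%N _ _)) (le 6%N _ _)).
all: by rewrite !inE eqxx ?orbT.
Qed.

Lemma quantization_error_Pf : quantization_error 4 (Pf R) = V%:E.
Proof.
apply/eqP; rewrite eq_le; apply/andP; split.
  rewrite -distortion_means; apply: ereal_inf_lbound.
  by exists means => //; exact: means_admissible.
by apply: le_ereal_inf_tmp => _ [alpha /distortion_Pf_ge[le _] <-].
Qed.

End four_means.

(* 112833 is split because number literals are unary. *)
Theorem proposition3p9 (R : realType) :
  (forall alpha : {fset R},
     optimal_means 4 (Pf R) alpha <-> alpha = [fset 1; 2; 3; a R 4 6]%fset) /\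
  quantization_error 4 (Pf R) = ((112 * 10 ^+ 3 + 833) / 10 ^+ 7)%:E.
Proof.
split; last exact: quantization_error_Pf.
move=> alpha; rewrite /optimal_means quantization_error_Pf; split.
  by move=> [/distortion_Pf_ge[_]] /[apply].
by move=> ->; split; [exact: means_admissible|exact: distortion_means].
Qed.
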